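(* There exists a continuous function $h_0:[0,+\infty)\to\mathbb R$ such that for every non-decreasing continuous function $h:[0,+\infty)\to\mathbb R$ the Fock type space $\mathcal F_{h_0}$ does not coincide, up to norm equivalence, with $\mathcal F_h$; that is, it is not the case that $\mathcal F_{h_0}=\mathcal F_h$ as sets with equivalent norms.
   Context: A continuous function (weight) $h$ on $[0,+\infty)$ is extended to $\mathbb C$ by $h(z)=h(|z|)$. The Fock type space is the Hilbert space of entire functions $$\mathcal F_h=\Bigl\{f \text{ entire}:\ \|f\|^2=\int_{\mathbb C}|f(z)|^2e^{-h(z)}\,dm(z)<\infty\Bigr\},$$ where $dm$ is area Lebesgue measure. *)

(* Defs.v *)
From HB Require Import structures.
From mathcomp Require Import all_boot all_order all_algebra.
From mathcomp Require Import all_classical all_reals all_analysis.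
From mathcomp Require Import complex.

Set Implicit Arguments.
Unset Strict Implicit.
Unset Printing Implicit Defensive.

Import Order.TTheory GRing.Theory Num.Theory.
Import numFieldNormedType.Exports.

Local Open Scope classical_set_scope.
Local Open Scope ring_scope.
Local Open Scope complex_scope.

(* The topology of R[i] is found through its [numFieldType] structure, hence
   the cast.  The direction 1 makes the quotient (f (z + k) - f z) / k with k
   ranging over the punctured neighbourhoods of 0 in R[i]. *)
Definition entire (R : realType) (f : R[i] -> R[i]) : Prop :=
  let C : numFieldType := R[i] in
  forall z : C, derivable (f : C^o -> C^o) z 1.

(* [Normc.normc] is the modulus with values in R (the norm of R[i] as a
   [numDomainType] takes its values in R[i]).  Only the values of [h] on
   [0, +oo[ matter. *)
Definition fock_sqnorm (R : realType) (h : R -> R) (f : R[i] -> R[i]) : \bar R :=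
  (\int[(@lebesgue_measure R \x @lebesgue_measure R)%E]_p
    ((Normc.normc (f (p.1 +i* p.2)) ^+ 2)
      * expR (- h (Normc.normc (p.1 +i* p.2))))%:E)%E.

Definition fock_space (R : realType) (h : R -> R) : set (R[i] -> R[i]) :=
  [set f | entire f /\ (fock_sqnorm h f < +oo)%E].

Definition fock_norm (R : realType) (h : R -> R) (f : R[i] -> R[i]) : R :=
  Num.sqrt (fine (fock_sqnorm h f)).

Definition fock_coincide (R : realType) (h1 h2 : R -> R) : Prop :=
  fock_space h1 = fock_space h2 /\
  exists c C : R, [/\ 0 < c, 0 < C &
    forall f, fock_space h1 f ->
      c * fock_norm h1 f <= fock_norm h2 f <= C * fock_norm h1 f].

(* Main.v *)
Require Import Defs.
From mathcomp Require Import all_boot all_order all_algebra.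
From mathcomp Require Import all_classical all_reals all_analysis.
From mathcomp Require Import complex measurable_realfun lra ring zify.
Import Order.TTheory GRing.Theory Num.Theory.
Import numFieldNormedType.Exports.
Local Open Scope classical_set_scope.
Local Open Scope ring_scope.

(* Only the norms of the monomials z^n matter.  With w(u) = exp(-h(sqrt u)) and
   u = |z|^2 they are the moments [mom n w], the plane integrals of u^n w(u).

   If w is non-increasing, one moment bounds w pointwise: w(u) <= C mom N w / u^(N+1).
   Hence for fixed N, c, B and a suitable d the interpolation inequality
   B mom (N+d) w <= c^d mom N w + c^(-d) mom (N+2d) w holds for all such w, because the
   part of the plane where (u/c)^d is bounded but not small shrinks to the circle u = c,
   a null set, as d grows.

   Conversely, let w0 be a sum of bumps centered at c_k = 2k+1 with rapidly decreasing
   amplitudes a_k, each sharply peaked.  Then mom n w0 is of order a_k c_k^n on a whole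
   range N_k <= n <= N_k + 2 d_k, where d_k is given by the inequality for B = k+1.
   For h0(r) = -ln w0(r^2) and norms equivalent to those of a non-decreasing h, this
   bounds k+1 by a constant independent of k. *)

Section PlaneRadial.
Context {R : realType}.
Implicit Types (F G : R -> R) (a b c s : R).

Definition plane : {measure set (measurableTypeR R * measurableTypeR R)%type -> \bar R} :=
  (@lebesgue_measure R \x @lebesgue_measure R)%E.

Definition sqnorm (p : R * R) : R := p.1 ^+ 2 + p.2 ^+ 2.

Lemma sqnorm_ge0 p : 0 <= sqnorm p.
Proof. by rewrite addr_ge0 ?sqr_ge0. Qed.

Lemma measurable_sqnorm : measurable_fun setT sqnorm.
Proof.
by apply: measurable_funD; apply: measurable_funX.
Qed.

Lemma measurable_sqnorm_comp F : measurable_fun setT F ->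
  measurable_fun setT (fun p => (F (sqnorm p))%:E).
Proof.
move=> mF; apply/measurable_EFinP.
exact: (measurableT_comp mF measurable_sqnorm).
Qed.

Definition radint F : \bar R := (\int[plane]_p (F (sqnorm p))%:E)%E.

Lemma measurable_sqnorm_preimage (A : set R) : measurable A -> measurable (sqnorm @^-1` A).
Proof.
by move=> mA; rewrite -[X in measurable X]setTI; apply: measurable_sqnorm.
Qed.

Lemma radint_ge0 F : (forall u, 0 <= u -> 0 <= F u) -> (0 <= radint F)%E.
Proof. by move=> F0; apply: integral_ge0 => p _; rewrite lee_fin F0 ?sqnorm_ge0. Qed.

Lemma le_radint F G : measurable_fun setT F -> measurable_fun setT G ->
  (forall u, 0 <= u -> 0 <= F u <= G u) -> (radint F <= radint G)%E.
Proof.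
move=> mF mG FG; apply: ge0_le_integral => //.
- by move=> p _; have /andP[] := FG _ (sqnorm_ge0 p); rewrite lee_fin.
- exact: measurable_sqnorm_comp.
- exact: measurable_sqnorm_comp.
- by move=> p _; have /andP[] := FG _ (sqnorm_ge0 p); rewrite lee_fin.
Qed.

Lemma eq_radint F G : (forall u, 0 <= u -> F u = G u) -> radint F = radint G.
Proof. by move=> FG; apply: eq_integral => p _; rewrite FG ?sqnorm_ge0. Qed.

Lemma radintD F G : measurable_fun setT F -> measurable_fun setT G ->
  (forall u, 0 <= u -> 0 <= F u) -> (forall u, 0 <= u -> 0 <= G u) ->
  radint (fun u => F u + G u) = (radint F + radint G)%E.
Proof.
move=> mF mG F0 G0; rewrite /radint -ge0_integralD //.
- by move=> p _; rewrite lee_fin F0 ?sqnorm_ge0.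
- exact: measurable_sqnorm_comp.
- by move=> p _; rewrite lee_fin G0 ?sqnorm_ge0.
- exact: measurable_sqnorm_comp.
Qed.

Lemma radintZl k F : measurable_fun setT F -> (forall u, 0 <= u -> 0 <= F u) ->
  0 <= k -> radint (fun u => k * F u) = (k%:E * radint F)%E.
Proof.
move=> mF F0 k0; rewrite /radint -ge0_integralZl_EFin //.
- by move=> p _; rewrite lee_fin F0 ?sqnorm_ge0.
- exact: measurable_sqnorm_comp.
Qed.

Lemma radint_indic (A : set R) : measurable A ->
  radint (\1_A) = plane (sqnorm @^-1` A).
Proof.
move=> mA; have mqA := measurable_sqnorm_preimage _ mA.
by rewrite -[in RHS](setIT (sqnorm @^-1` A)) -(integral_indic plane measurableT mqA).
Qed.

Lemma plane_sqnorm_bounded_lty s : (plane (sqnorm @^-1` `]-oo, s[%classic) < +oo)%E.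
Proof.
have [s0|s0] := leP s 0.
  rewrite (_ : _ @^-1` _ = set0) ?measure0 //.
  rewrite -subset0 => p /=; rewrite in_itv /= => ps.
  by have := sqnorm_ge0 p; rewrite leNgt (lt_le_trans ps).
set r := Num.sqrt s.
apply: (@le_lt_trans _ _ (plane (`[- r, r]%classic `*` `[- r, r]%classic))).
  apply: le_measure; rewrite ?inE.
  - exact: measurable_sqnorm_preimage.
  - exact: measurableX.
  - move=> [x y] /=; rewrite !in_itv /= /sqnorm /= => xys.
    rewrite -!ler_norml -!(sqrtr_sqr x) -!(sqrtr_sqr y).
    have := sqr_ge0 x; have := sqr_ge0 y.
    by move=> ? ?; split; apply: ler_wsqrtr; lra.
rewrite [plane _]product_measure1E //=.
rewrite !lebesgue_measure_itv /=.
by case: ifP => _; rewrite -?EFinM ?ltry // mule0.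
Qed.

Lemma plane_circle0 c : plane (sqnorm @^-1` [set c]) = 0%E.
Proof.
rewrite /plane /= /product_measure1 /=.
apply: integral0_eq => x _ /=.
apply: countable_lebesgue_measure0.
apply: (@sub_countable _ _ _ [set Num.sqrt (c - x ^+ 2); - Num.sqrt (c - x ^+ 2)]).
  apply: subset_card_le => y; rewrite /xsection /= inE /sqnorm /= => <-.
  rewrite addrAC subrr add0r sqrtr_sqr.
  by case: (leP 0 y) => y0; [left; rewrite ger0_norm | right; rewrite ltr0_norm // opprK].
by apply: finite_set_countable; rewrite finite_setU; split; apply: finite_set1.
Qed.

Definition boxarea (a b : R) : R :=
  (Num.sqrt ((a + b) / 2) - Num.sqrt a) * Num.sqrt ((b - a) / 2).

Lemma boxarea_gt0 a b : 0 <= a < b -> 0 < boxarea a b.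
Proof.
move=> /andP[a0 ab]; apply: mulr_gt0; last by rewrite sqrtr_gt0; lra.
by rewrite subr_gt0 ltr_sqrt; lra.
Qed.

Lemma boxarea_scale s a b : 0 <= s -> 0 <= a ->
  boxarea (s * a) (s * b) = s * boxarea a b.
Proof.
move=> s0 a0; rewrite /boxarea -mulrDr -mulrBr -!mulrA !(sqrtrM _ s0).
by rewrite -{4}(sqr_sqrtr s0); ring.
Qed.

Lemma plane_annulus_ge a b : 0 <= a < b ->
  ((boxarea a b)%:E <= plane (sqnorm @^-1` `[a, b[%classic))%E.
Proof.
move=> /andP[a0 ab].
set x0 := Num.sqrt a; set x1 := Num.sqrt ((a + b) / 2); set y1 := Num.sqrt ((b - a) / 2).
have x01 : x0 < x1 by rewrite ltr_sqrt; lra.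
have y10 : 0 < y1 by rewrite sqrtr_gt0; lra.
apply: (@le_trans _ _ (plane (`[x0, x1[%classic `*` `[0, y1[%classic))).
  rewrite [X in (_ <= X)%E]product_measure1E //= !lebesgue_measure_itv /= !lte_fin x01 y10.
  by rewrite -EFinB -EFinM /boxarea subr0.
apply: le_measure; rewrite ?inE.
- exact: measurableX.
- exact: measurable_sqnorm_preimage.
- move=> [x y] /=; rewrite !in_itv /= /sqnorm /= => -[/andP[xa xb] /andP[ya yb]].
  have x0ge : 0 <= x0 := sqrtr_ge0 _.
  have hx0 : x0 ^+ 2 = a by rewrite sqr_sqrtr.
  have hx1 : x1 ^+ 2 = (a + b) / 2 by rewrite sqr_sqrtr //; lra.
  have hy1 : y1 ^+ 2 = (b - a) / 2 by rewrite sqr_sqrtr //; lra.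
  have h1 : x0 ^+ 2 <= x ^+ 2 by rewrite ler_pXn2r ?nnegrE //; lra.
  have h2 : x ^+ 2 < x1 ^+ 2 by rewrite ltr_pXn2r ?nnegrE //; lra.
  have h3 : y ^+ 2 < y1 ^+ 2 by rewrite ltr_pXn2r ?nnegrE //; lra.
  by have := sqr_ge0 y; lra.
Qed.

End PlaneRadial.

Section RadialMoments.
Context {R : realType}.
Implicit Types (w : R -> R) (c s u : R) (n N d : nat).

Definition mom n w : \bar R := radint (fun u => u ^+ n * w u).

Definition radial_weight w := measurable_fun setT w /\ forall u, 0 <= u -> 0 <= w u.

Lemma measurable_mom n w : measurable_fun setT w ->
  measurable_fun setT (fun u : R => u ^+ n * w u).
Proof. by move=> mw; apply: measurable_funM => //; apply: measurable_funX. Qed.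

Lemma mom_integrand_ge0 n w : radial_weight w -> forall u, 0 <= u -> 0 <= u ^+ n * w u.
Proof. by move=> [_ w0] u u0; rewrite mulr_ge0 ?exprn_ge0 ?w0. Qed.

Lemma mom_ge0 n w : radial_weight w -> (0 <= mom n w)%E.
Proof. by move=> hw; apply/radint_ge0/mom_integrand_ge0. Qed.

Lemma monotone_weight_le_mom N : exists2 k : R, 0 < k & forall w,
  radial_weight w -> {in `[0, +oo[ &, {homo w : x y / x <= y >-> y <= x}} ->
  forall u, 0 < u -> ((k * u ^+ N.+1 * w u)%:E <= mom N w)%E.
Proof.
have b0 : 0 < boxarea (1 / 2) (1 : R) by apply: boxarea_gt0; lra.
exists (boxarea (1 / 2) 1 / 2 ^+ N); first by rewrite divr_gt0 ?exprn_gt0.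
move=> w hw wmono u u0; have [mw w0] := hw.
have wu0 : 0 <= w u by rewrite w0 // ltW.
set A := `[u * (1 / 2), u * 1[%classic.
have mA : measurable A by exact: measurable_itv.
set K := (u / 2) ^+ N * w u.
have K0 : 0 <= K by rewrite mulr_ge0 // exprn_ge0 //; lra.
apply: (@le_trans _ _ (radint (fun v => K * \1_A v))).
  rewrite radintZl //.
  rewrite radint_indic //.
  apply: (@le_trans _ _ (K%:E * (boxarea (u * (1 / 2)) (u * 1))%:E)%E).
    rewrite boxarea_scale; [|by lra|by lra].
    rewrite -EFinM lee_fin /K expr_div_n exprSr le_eqVlt; apply/orP; left; apply/eqP.
    by field.
  by apply: lee_wpmul2l; [rewrite lee_fin | apply: plane_annulus_ge; lra].
apply: le_radint.
- by apply: measurable_funM => //; exact: measurable_indic.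
- exact: measurable_mom.
- move=> v v0; rewrite indicE; case: (boolP (v \in A)) => vA; last first.
    by rewrite mulr0 lexx mulr_ge0 ?exprn_ge0 ?w0.
  rewrite mulr1 K0 /=; move: vA; rewrite inE /A /= in_itv /= => /andP[v1 v2].
  apply: ler_pM => //; first by rewrite exprn_ge0 //; lra.
    by apply: lerXn2r; rewrite ?nnegrE //; lra.
  by apply: wmono; rewrite ?in_itv /= ?andbT; lra.
Qed.

Definition concentrator c K n u : R := if (u / c) ^+ n.+1 < K then (u / c) ^+ n / c else 0.

Lemma measurable_concentrator c K n : measurable_fun setT (concentrator c K n).
Proof.
have mp k : measurable_fun setT (fun u : R => (u / c) ^+ k).
  by apply: measurable_funX; apply: measurable_funM.
rewrite /concentrator; apply: measurable_fun_ifT => //.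
  by apply: measurable_fun_ltr.
exact: measurable_funM.
Qed.

Lemma concentrator_le c K n u : 0 < c -> 1 <= K -> 0 <= u ->
  0 <= concentrator c K n u <= K / c * \1_(`]-oo, (c * K)[%classic) u.
Proof.
move=> c0 K1 u0; rewrite /concentrator; case: ifPn => [hK|_]; last first.
  by rewrite lexx mulr_ge0 // divr_ge0 //; lra.
have uc0 : 0 <= u / c by rewrite divr_ge0 // ltW.
rewrite divr_ge0 ?exprn_ge0 ?(ltW c0) //=.
have [uc|cu] := ltP u c.
  have uK : u < c * K by rewrite (lt_le_trans uc) // ler_peMr // ltW.
  rewrite indicE mem_set /= ?in_itv //= mulr1 ler_pM2r ?invr_gt0 //.
  apply: le_trans K1.
  by apply: exprn_ile1 => //; rewrite ler_pdivrMr // mul1r ltW.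
have uc1 : 1 <= u / c by rewrite ler_pdivlMr // mul1r.
have ucK : u / c < K by apply: le_lt_trans hK; rewrite ler_eXnr.
have uK : u < c * K by move: ucK; rewrite ltr_pdivrMr // mulrC.
rewrite indicE mem_set /= ?in_itv //= mulr1 ler_pM2r ?invr_gt0 // ltW //.
by apply: le_lt_trans hK; rewrite ler_weXn2l.
Qed.

Lemma radint_concentrator_small c K e : 0 < c -> 1 <= K -> 0 < e ->
  exists n, (radint (concentrator c K n) <= e%:E)%E.
Proof.
move=> c0 K1 e0.
have Kc0 : 0 <= K / c by rewrite divr_ge0 ?(ltW c0) // (le_trans ler01).
pose D := @plane R; pose S : set R := `]-oo, (c * K)[%classic.
have mS : measurable S by exact: measurable_itv.
have mSf : measurable_fun setT (fun u : R => K / c * \1_S u).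
  apply: measurable_funM; first exact: measurable_cst.
  exact: measurable_indic.
have iS : D.-integrable setT (fun p => (K / c * \1_S (sqnorm p))%:E).
  apply/integrableP; split; first exact: (measurable_sqnorm_comp _ mSf).
  rewrite (_ : (\int[_]_(x in _) _)%E = radint (fun u => K / c * \1_S u)).
    rewrite radintZl //.
    rewrite radint_indic // lte_mul_pinfty ?lee_fin //.
    exact: plane_sqnorm_bounded_lty.
  apply: eq_integral => p _; by rewrite gee0_abs // lee_fin mulr_ge0.
have [] := @dominated_convergence _ _ _ D setT measurableT
  (fun n p => (concentrator c K n (sqnorm p))%:E) (cst 0%E)
  (fun p => (K / c * \1_S (sqnorm p))%:E).
- by move=> n; exact: (measurable_sqnorm_comp _ (measurable_concentrator c K n)).
- exact: measurable_cst.
- exists (sqnorm @^-1` [set c]); split.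
  + exact: measurable_sqnorm_preimage.
  + exact: plane_circle0.
  + move=> p /= h; apply: contrapT => pc; apply: h => _.
    have q0 := sqnorm_ge0 p; move: pc q0; move: (sqnorm p) => u uc u0.
    apply/fine_cvgP; split; first exact: nearW.
    have [uc1|cu] := ltP u c.
      apply: (@squeeze_cvgr _ _ _ _ (cst 0) (fun n => (u / c) ^+ n / c)).
      * near=> n; rewrite /= /concentrator.
        have uc0 : 0 <= u / c by rewrite divr_ge0 // ltW.
        by case: ifP => _; rewrite ?lexx divr_ge0 ?exprn_ge0 // ltW.
      * exact: cvg_cst.
      * rewrite -(mul0r c^-1); apply: cvgMl; apply: cvg_expr.
        by rewrite ger0_norm ?divr_ge0 ?(ltW c0) // ltr_pdivrMr // mul1r.
    have ugt0 : 0 < u by apply: lt_le_trans cu.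
    have uc1 : c / u < 1.
      by rewrite ltr_pdivrMr // mul1r lt_neqAle cu andbT; apply/eqP => cE; apply: uc.
    have cu0 : 0 < c / u by rewrite divr_gt0.
    apply: (@cvg_near_cst _ _ 0).
    have /cvg_expr/cvgr_lt/(_ K^-1) : `|c / u| < 1 by rewrite gtr0_norm.
    rewrite invr_gt0 => /(_ (lt_le_trans ltr01 K1)) [N _ hN].
    exists N => // n /= Nn; rewrite /concentrator ltNge.
    have := hN n.+1 (leqW Nn); rewrite -(invf_div u c) exprVn ltf_pV2 ?posrE.
    + by move=> /ltW ->.
    + by rewrite exprn_gt0 // divr_gt0.
    + exact: lt_le_trans K1.
- exact: iS.
- apply: aeW => p n _ /=; rewrite lee_fin.
  have /andP[h1 h2] := concentrator_le c K n (sqnorm p) c0 K1 (sqnorm_ge0 p).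
  by rewrite ger0_norm.
- move=> _ _; rewrite integral0 => /fine_cvgP[fin /cvgrPdist_le /(_ e e0) cv].
  have [N _ hN] : \forall n \near \oo,
      (radint (concentrator c K n) <= e%:E)%E.
    near=> n.
    have f1 : (radint (concentrator c K n) \is a fin_num)%E by near: n.
    rewrite -(fineK f1) lee_fin.
    have : `|0 - fine (radint (concentrator c K n))| <= e by near: n.
    by rewrite sub0r normrN; apply: le_trans; exact: ler_norm.
  by exists N; apply: hN => /=.
Unshelve. all: by end_near.
Qed.

Definition interpolated N c (B : R) d := forall w,
  radial_weight w -> {in `[0, +oo[ &, {homo w : x y / x <= y >-> y <= x}} ->
  (mom (N + d) w <= (c ^+ d / B)%:E * mom N w
     + ((B * c ^+ d)^-1)%:E * mom (N + d.*2) w)%E.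

(* Pointwise, either (u / c) ^ d < K, and then the monotone bound on [w u] makes
   the integrand a multiple of [concentrator], or u ^ (N + d) <= u ^ (N + 2 d) / (K c ^ d). *)
Lemma mom_interpolation N c B : 0 < c -> 0 < B -> exists d, interpolated N c B d.
Proof.
move=> c0 B0; have [k k0 hk] := monotone_weight_le_mom N.
set K := Num.max 1 B.
have K1 : 1 <= K by rewrite le_max lexx.
have BK : B <= K by rewrite le_max lexx orbT.
have [n hd] := radint_concentrator_small c K (k / B) c0 K1 (divr_gt0 k0 B0).
set d := n.+1; have d0 : (0 < d)%N by [].
exists d => w hw wmono; have [mw w0] := hw.
have cd0 : 0 < c ^+ d by rewrite exprn_gt0.
have [moo|mlt] := eqVneq (mom N w) +oo%E.
  rewrite moo gt0_muley ?lte_fin ?divr_gt0 // addye ?leey //.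
  by rewrite gt_eqF // (lt_le_trans (ltNy0)) // mule_ge0 ?mom_ge0 // lee_fin invr_ge0 mulr_ge0 ?ltW.
have mfin : mom N w \is a fin_num by rewrite ge0_fin_numE ?mom_ge0 // lt_neqAle mlt leey.
set m := fine (mom N w).
have mE : mom N w = m%:E by rewrite fineK.
have m0 : 0 <= m by rewrite -lee_fin -mE mom_ge0.
have conc0 u : 0 <= u -> 0 <= concentrator c K n u.
  by move=> u0; case/andP: (concentrator_le c K n u c0 K1 u0).
apply: (@le_trans _ _ (radint (fun u => m / k * c ^+ d * concentrator c K n u
    + (B * c ^+ d)^-1 * (u ^+ (N + d.*2) * w u)))).
  apply: le_radint.
  - exact: measurable_mom.
  - apply: measurable_funD; apply: measurable_funM => //.
    + exact: measurable_concentrator.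
    + exact: measurable_mom.
  - move=> u u0; rewrite mom_integrand_ge0 //=.
    have [->|un0] := eqVneq u 0.
      by rewrite exprD !expr0n (gtn_eqF d0) mulr0 mul0r addr_ge0 // mulr_ge0 ?conc0 //
        ?mulr_ge0 ?divr_ge0 ?invr_ge0 ?exprn_ge0 ?w0 // ltW // mulr_gt0.
    have ugt0 : 0 < u by rewrite lt_neqAle eq_sym un0.
    rewrite /concentrator -/d; case: ifPn => [_|].
      rewrite -[leLHS]addr0 lerD //; last first.
        by rewrite mulr_ge0 ?mom_integrand_ge0 // invr_ge0 mulr_ge0 // ltW.
      have := hk w hw wmono u ugt0; rewrite mE lee_fin => h.
      rewrite exprD expr_div_n.
      have -> : u ^+ n = u ^+ d / u by rewrite /d exprSr mulfK.
      have -> : c ^+ n = c ^+ d / c by rewrite /d exprSr mulfK // gt_eqF.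
      rewrite (_ : _ * _ * w u = (k * u ^+ N.+1 * w u) * (k^-1 * u ^+ d / u)); last first.
        by rewrite exprSr; field; rewrite un0 gt_eqF.
      rewrite (_ : m / k * _ * _ = m * (k^-1 * u ^+ d / u)); last first.
        by field; rewrite un0 !gt_eqF.
      by rewrite ler_wpM2r // ?divr_ge0 ?mulr_ge0 ?invr_ge0 ?exprn_ge0 // ltW.
    rewrite -leNgt expr_div_n => Kud; rewrite mulr0 add0r.
    rewrite -addnn addnA (exprD u (N + d) d).
    rewrite -[leLHS]mul1r (_ : _^-1 * _ = (u ^+ d / c ^+ d / B) * (u ^+ (N + d) * w u)); last first.
      by field; rewrite !gt_eqF.
    rewrite ler_wpM2r ?mom_integrand_ge0 // ler_pdivlMr // mul1r.
    exact: le_trans Kud.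
rewrite radintD; [|by apply: measurable_funM => //; exact: measurable_concentrator
  |by apply: measurable_funM => //; exact: measurable_mom
  |by move=> u u0; rewrite !mulr_ge0 ?conc0 ?invr_ge0 // ltW
  |by move=> u u0; rewrite mulr_ge0 ?mom_integrand_ge0 // invr_ge0 mulr_ge0 // ltW].
rewrite !radintZl; [|exact: measurable_mom|exact: mom_integrand_ge0|by rewrite invr_ge0 mulr_ge0 // ltW
  |exact: measurable_concentrator|exact: conc0|by rewrite !mulr_ge0 ?invr_ge0 // ltW].
apply: leeD => //; rewrite mE -EFinM.
apply: (@le_trans _ _ ((m / k * c ^+ d)%:E * (k / B)%:E)%E).
  by apply: lee_wpmul2l => //; rewrite lee_fin !mulr_ge0 ?invr_ge0 // ltW.
rewrite -EFinM lee_fin le_eqVlt; apply/orP; left; apply/eqP.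
by field; rewrite !gt_eqF.
Qed.

End RadialMoments.

Section Bumps.
Context {R : realType}.
Implicit Types (w : R -> R) (c r u : R) (n M : nat).

Definition tent c r u : R := Num.max 0 (r - `|u - c|).

Lemma tent_ge0 c r u : 0 <= tent c r u.
Proof. by rewrite le_max lexx. Qed.

Lemma tent_gt0 c r u : `|u - c| < r -> 0 < tent c r u.
Proof. by move=> h; rewrite lt_max subr_gt0 h orbT. Qed.

Lemma tent_eq0 c r u : r <= `|u - c| -> tent c r u = 0.
Proof. by move=> h; apply/max_idPl; rewrite subr_le0. Qed.

Lemma continuous_tent c r : continuous (tent c r).
Proof.
move=> u; apply: (@continuous_max _ _ (cst 0) (fun u : R => r - `|u - c|)); first exact: cvg_cst.
apply: cvgB; first exact: cvg_cst.
by apply: cvg_norm; apply: cvgB; [exact: cvg_id|exact: cvg_cst].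
Qed.

Lemma radial_weight_continuous w : continuous w -> (forall u, 0 <= w u) -> radial_weight w.
Proof. by move=> cw w0; split => [|u _]; [exact: continuous_measurable_fun|exact: w0]. Qed.

Lemma radial_weight_tent c r : radial_weight (tent c r).
Proof. by apply: radial_weight_continuous; [exact: continuous_tent|exact: tent_ge0]. Qed.

Lemma mom_le_of_support n w b : radial_weight w ->
  (forall u, b <= u -> w u = 0) -> 0 <= b -> (mom n w <= (b ^+ n)%:E * mom 0 w)%E.
Proof.
move=> hw wb b0; have [mw w0] := hw.
rewrite /mom -radintZl ?exprn_ge0 //; [|exact: measurable_mom|exact: mom_integrand_ge0].
apply: le_radint; [exact: measurable_mom|by apply: measurable_funM => //; exact: measurable_mom|].
move=> u u0; rewrite mom_integrand_ge0 //= expr0 mul1r.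
have [ub|bu] := ltP u b; last by rewrite wb // !mulr0.
by rewrite ler_wpM2r ?w0 // lerXn2r ?nnegrE // ltW.
Qed.

Lemma mom_ge_of_support n w a : radial_weight w ->
  (forall u, u <= a -> w u = 0) -> 0 <= a -> ((a ^+ n)%:E * mom 0 w <= mom n w)%E.
Proof.
move=> hw wb a0; have [mw w0] := hw.
rewrite /mom -radintZl ?exprn_ge0 //; [|exact: measurable_mom|exact: mom_integrand_ge0].
apply: le_radint; [by apply: measurable_funM => //; exact: measurable_mom|exact: measurable_mom|].
move=> u u0; rewrite mulr_ge0 ?exprn_ge0 ?mom_integrand_ge0 //= expr0 mul1r.
have [au|ua] := ltP a u; last by rewrite wb // !mulr0.
by rewrite ler_wpM2r ?w0 // lerXn2r ?nnegrE // ltW.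
Qed.

Lemma momD n w v : radial_weight w -> radial_weight v ->
  mom n (fun u => w u + v u) = (mom n w + mom n v)%E.
Proof.
move=> hw hv; have [mw w0] := hw; have [mv v0] := hv.
rewrite /mom -radintD; [|exact: measurable_mom|exact: measurable_mom
  |exact: mom_integrand_ge0|exact: mom_integrand_ge0].
by apply: eq_radint => u _; rewrite mulrDr.
Qed.

Lemma momZ n k w : radial_weight w -> 0 <= k ->
  mom n (fun u => k * w u) = (k%:E * mom n w)%E.
Proof.
move=> hw k0; have [mw w0] := hw.
rewrite /mom -radintZl //; [|exact: measurable_mom|exact: mom_integrand_ge0].
by apply: eq_radint => u _; rewrite mulrCA.
Qed.

Lemma radial_weightZ k w : radial_weight w -> 0 <= k -> radial_weight (fun u => k * w u).
Proof.
by move=> [mw w0] k0; split; [exact: measurable_funM|move=> u u0; rewrite mulr_ge0 ?w0].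
Qed.

Lemma tent_mass c r : 0 <= c -> 0 < r -> exists2 m : R, 0 < m & mom 0 (tent c r) = m%:E.
Proof.
move=> c0 r0; have [mt t0] := radial_weight_tent c r.
have pos : (0 < mom 0 (tent c r))%E.
  set A := `[c, c + r / 2[%classic.
  have mA : measurable A by exact: measurable_itv.
  apply: (@lt_le_trans _ _ (radint (fun u => r / 2 * \1_A u))); last first.
    apply: le_radint.
    - by apply: measurable_funM; [exact: measurable_cst|exact: measurable_indic].
    - exact: measurable_mom.
    - move=> u u0; rewrite expr0 mul1r indicE.
      have [|] := boolP (u \in A); last by rewrite mulr0 lexx tent_ge0.
      rewrite inE /A /= in_itv /= mulr1 => /andP[cu ur].
      by rewrite le_max ger0_norm; lra.
  have r20 : 0 < r / 2 by lra.
  rewrite radintZl // ?(ltW r20) // radint_indic // mule_gt0 ?lte_fin //.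
  apply: (@lt_le_trans _ _ (boxarea c (c + r / 2))%:E).
    by rewrite lte_fin boxarea_gt0 //; lra.
  by apply: plane_annulus_ge; lra.
have fin : (mom 0 (tent c r) < +oo)%E.
  set A := `]-oo, c + r[%classic.
  have mA : measurable A by exact: measurable_itv.
  apply: (@le_lt_trans _ _ (radint (fun u => r * \1_A u))).
    apply: le_radint.
    - exact: measurable_mom.
    - by apply: measurable_funM; [exact: measurable_cst|exact: measurable_indic].
    - move=> u u0; rewrite expr0 mul1r indicE tent_ge0 /=.
      have [|] := boolP (u \in A).
        by rewrite mulr1 /tent ge_max (ltW r0) /= lerBlDr lerDl.
      rewrite notin_setE /A /= in_itv /= => /negP; rewrite -leNgt => h.
      by rewrite mulr0 tent_eq0 // (le_trans _ (ler_norm _)) //; lra.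
  rewrite radintZl ?(ltW r0) //.
  by rewrite radint_indic // lte_mul_pinfty ?lee_fin ?(ltW r0) // plane_sqnorm_bounded_lty.
have f : mom 0 (tent c r) \is a fin_num by rewrite ge0_fin_numE // ltW.
exists (fine (mom 0 (tent c r))); last by rewrite fineK.
by rewrite -lte_fin fineK.
Qed.

Definition bump c M (phi : R -> R) :=
  [/\ continuous phi, (forall u, 0 <= phi u),
    (forall u, `|u - c| < 3 / 2 -> 0 < phi u),
    (forall u, 3 / 2 <= `|u - c| -> phi u = 0) &
    forall n, (n <= M)%N -> ((c ^+ n / 2)%:E <= mom n phi <= (2 * c ^+ n)%:E)%E].

Lemma pow_near1 M : exists2 t : R, 0 < t <= 1 / 2 &
  forall n, (n <= M)%N -> 1 / 2 <= (1 - t) ^+ n /\ (1 + t) ^+ n <= 3 / 2.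
Proof.
have : (fun x : R => x ^+ M) @ (1 : R) --> ((1 : R) ^+ M) by exact: exprn_continuous.
rewrite expr1n => /cvgrPdist_lt /(_ (1 / 2)).
have h2 : 0 < 1 / 2 :> R by lra.
move=> /(_ h2) /nbhs_ballP [e /= e0 he].
have [t [t0 te t2]] : exists t : R, [/\ 0 < t, t < e & t <= 1 / 2].
  exists (Num.min (e / 2) (1 / 2)); split.
  - by rewrite lt_min h2 divr_gt0.
  - by rewrite gt_min; apply/orP; left; rewrite ltr_pdivrMr // mulr2n mulrDr mulr1 ltrDl.
  - by rewrite ge_min lexx orbT.
exists t; first by rewrite t0.
move=> n nM.
have /ltr_normlP[_ h1] := he (1 - t) ltac:(rewrite /ball /= opprB addrC subrK gtr0_norm //).
have /ltr_normlP[h3 _] := he (1 + t) ltac:(rewrite /ball /= opprD addrA subrr sub0r normrN gtr0_norm //).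
split.
  apply: (@le_trans _ _ ((1 - t) ^+ M)); first lra.
  by apply: ler_wiXn2l => //; lra.
apply: (@le_trans _ _ ((1 + t) ^+ M)); last lra.
by apply: ler_weXn2l => //; lra.
Qed.

Lemma bump_exists c M : 1 <= c -> exists phi, bump c M phi.
Proof.
move=> c1; have c0 : 0 < c by lra.
have [t /andP[t0 t2] ht] := pow_near1 M.
pose d := Num.min (c * t) 1.
have d0 : 0 < d by rewrite lt_min ltr01 mulr_gt0.
have dct : d <= c * t by rewrite ge_min lexx.
have d1 : d <= 1 by rewrite ge_min lexx orbT.
have [m m0 mE] := tent_mass c d (ltW c0) d0.
have [m' m'0 m'E] := tent_mass c (3 / 2) (ltW c0) ltac:(lra).
pose B := (c + 3 / 2) ^+ M.
have B0 : 0 < B by rewrite exprn_gt0 //; lra.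
pose e := (2 * B * m')^-1.
have e0 : 0 < e by rewrite invr_gt0 !mulr_gt0.
have im0 : 0 < m^-1 by rewrite invr_gt0.
have rt r := radial_weight_tent c r.
exists (fun u => m^-1 * tent c d u + e * tent c (3 / 2) u); split.
- move=> u; apply: cvgD; (apply: cvgM; first exact: cvg_cst); exact: continuous_tent.
- by move=> u; apply: addr_ge0; apply: mulr_ge0; (exact: tent_ge0) || (exact: ltW).
- move=> u hu; rewrite ltr_wpDl //; first by apply: mulr_ge0; [exact: ltW|exact: tent_ge0].
  by rewrite mulr_gt0 // tent_gt0.
- move=> u hu; rewrite !tent_eq0 ?mulr0 ?addr0 //.
  by apply: le_trans hu; lra.
move=> n nM; have [h1 h2] := ht n nM.
have cn0 : 0 < c ^+ n by rewrite exprn_gt0.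
rewrite momD; [|by apply: radial_weightZ => //; rewrite invr_ge0 ltW
  |by apply: radial_weightZ => //; exact: ltW].
rewrite !momZ ?(ltW e0) ?(ltW im0) //.
have low : ((c ^+ n / 2)%:E <= (m^-1)%:E * mom n (tent c d))%E.
  apply: (@le_trans _ _ ((m^-1)%:E * ((c - d) ^+ n * m)%:E)%E).
    rewrite -EFinM lee_fin mulrCA mulVf ?gt_eqF // mulr1.
    apply: (@le_trans _ _ ((c * (1 - t)) ^+ n)).
      by rewrite exprMn ler_pM2l //; lra.
    apply: lerXn2r; rewrite ?nnegrE; nra.
  apply: lee_wpmul2l; first by rewrite lee_fin invr_ge0 ltW.
  rewrite EFinM -mE; apply: mom_ge_of_support => //; last by nra.
  by move=> u hu; rewrite tent_eq0 // distrC (le_trans _ (ler_norm _)) //; lra.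
have up : ((m^-1)%:E * mom n (tent c d) <= (3 / 2 * c ^+ n)%:E)%E.
  apply: (@le_trans _ _ ((m^-1)%:E * ((c + d) ^+ n * m)%:E)%E).
    apply: lee_wpmul2l; first by rewrite lee_fin invr_ge0 ltW.
    rewrite EFinM -mE; apply: mom_le_of_support => //; last by lra.
    by move=> u hu; rewrite tent_eq0 // (le_trans _ (ler_norm _)) //; lra.
  rewrite -EFinM lee_fin mulrCA mulVf ?gt_eqF // mulr1.
  apply: (@le_trans _ _ ((c * (1 + t)) ^+ n)).
    by apply: lerXn2r; rewrite ?nnegrE; nra.
  by rewrite exprMn mulrC ler_pM2r.
have wide : (e%:E * mom n (tent c (3 / 2)) <= (c ^+ n / 2)%:E)%E.
  apply: (@le_trans _ _ (e%:E * (B * m')%:E)%E).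
    apply: lee_wpmul2l; first by rewrite lee_fin ltW.
    apply: (@le_trans _ _ (((c + 3 / 2) ^+ n)%:E * mom 0 (tent c (3 / 2)))%E).
      apply: mom_le_of_support => //; last by lra.
      by move=> u hu; rewrite tent_eq0 // (le_trans _ (ler_norm _)) //; lra.
    rewrite m'E -EFinM lee_fin ler_pM2r // /B; apply: ler_weXn2l => //; lra.
  rewrite -EFinM lee_fin (_ : e * _ = 1 / 2).
    by have := exprn_ege1 n c1; lra.
  by rewrite /e; field; rewrite !gt_eqF.
apply/andP; split.
  apply: (le_trans low); rewrite leeDl // mule_ge0 ?lee_fin ?(ltW e0) //.
  exact: mom_ge0.
apply: (le_trans (leeD up wide)); rewrite -EFinD lee_fin; lra.
Qed.

End Bumps.

Section ClusteredWeight.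
Context {R : realType}.
Implicit Types (u : R) (j k m n : nat).

Definition center j : R := (j.*2.+1)%:R.

Lemma centerE j : center j = 2 * j%:R + 1.
Proof. by rewrite /center -addn1 natrD -mul2n natrM. Qed.

Lemma center_ge1 j : 1 <= center j.
Proof. by rewrite centerE; have := ler0n R j; lra. Qed.

Lemma pow_ratio_small k (a : R) : 0 < a -> exists N, forall n, (N <= n)%N ->
  2 * 2 ^+ k * (center k - 1 / 2) ^+ n <= a * center k ^+ n.
Proof.
move=> a0; have c1 := center_ge1 k; have c0 : 0 < center k by lra.
have r0 : 0 <= (center k - 1 / 2) / center k by rewrite divr_ge0 //; lra.
have /cvg_expr/cvgr_lt/(_ (a / (2 * 2 ^+ k))) : `|(center k - 1 / 2) / center k| < 1.
  by rewrite ger0_norm // ltr_pdivrMr //; lra.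
have k0 : 0 < 2 * 2 ^+ k :> R by rewrite mulr_gt0 ?exprn_gt0.
move=> /(_ (divr_gt0 a0 k0)) [N _ hN]; exists N => n /hN /=.
rewrite expr_div_n ltr_pdivrMr ?exprn_gt0 // mulrAC ltr_pdivlMr // => /ltW.
by rewrite mulrC.
Qed.

Record stage := Stage { amp : R; low : nat; gap : nat }.

Definition high (s : stage) := (low s + (gap s).*2)%N.

Definition admissible k (s : stage) := [/\ 0 < amp s <= 1,
  interpolated (low s) (center k) k.+1%:R (gap s) &
  forall n, (low s <= n)%N ->
    2 * 2 ^+ k * (center k - 1 / 2) ^+ n <= amp s * center k ^+ n].

Definition successive j (s t : stage) := (high s <= low t)%N /\
  amp t * 2 ^+ j.+3 * (center j.+1 + 3 / 2) ^+ high s = amp s.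

Lemma admissible_exists k M (a : R) : 0 < a <= 1 ->
  exists s, [/\ admissible k s, amp s = a & (M <= low s)%N].
Proof.
move=> /andP[a0 a1]; have [N hN] := pow_ratio_small k a a0.
have c0 : 0 < center k by apply: lt_le_trans (center_ge1 k).
have [d hd] := mom_interpolation (maxn M N) (center k) k.+1%:R c0 (ltr0Sn _ _).
exists (Stage a (maxn M N) d); split => //=; last exact: leq_maxl.
split=> //=; first by rewrite a0.
by move=> n hn; apply: hN; exact: leq_trans (leq_maxr _ _) hn.
Qed.

Lemma successor_exists j s : 0 < amp s <= 1 ->
  exists t, admissible j.+1 t /\ successive j s t.
Proof.
move=> /andP[a0 a1]; pose q := 2 ^+ j.+3 * (center j.+1 + 3 / 2) ^+ high s.
have c1 := center_ge1 j.+1.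
have q1 : 1 <= q by apply: mulr_ege1; apply: exprn_ege1; lra.
have q0 : 0 < q by lra.
have [|t [ht ta tM]] := admissible_exists j.+1 (high s) (amp s / q).
  by rewrite divr_gt0 //= ler_pdivrMr // mul1r; lra.
exists t; split=> //; split=> //.
by rewrite -mulrA ta divfK // gt_eqF.
Qed.

Lemma stages_exist : exists f : nat -> stage,
  (forall k, admissible k (f k)) /\ (forall k, successive k (f k) (f k.+1)).
Proof.
have [s0 [h0 _ _]] := admissible_exists 0 0 1 ltac:(rewrite ltr01 lexx //).
have [g hg] : {g : nat * stage -> stage & forall x, 0 < amp x.2 <= 1 ->
    admissible x.1.+1 (g x) /\ successive x.1 x.2 (g x)}.
  apply: (@choice _ _ (fun x t => 0 < amp x.2 <= 1 ->
    admissible x.1.+1 t /\ successive x.1 x.2 t)) => -[j s] /=.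
  have [hs|hs] := pselect (0 < amp s <= 1 : Prop); last by exists s.
  by have [t ht] := successor_exists j s hs; exists t.
pose f := fix f k := if k is j.+1 then g (j, f j) else s0.
have fA k : admissible k (f k).
  by elim: k => [//|k [hk _ _]] /=; have [] := hg (k, f k) hk.
exists f; split => // k; have [hk _ _] := fA k.
by have [] := hg (k, f k) hk.
Qed.

Section Sum.
Variables (f : nat -> stage) (phi : nat -> R -> R).
Hypothesis fA : forall k, admissible k (f k).
Hypothesis fS : forall k, successive k (f k) (f k.+1).
Hypothesis phiB : forall k, bump (center k) (high (f k)) (phi k).

Let a k := amp (f k).

Let a_gt0 k : 0 < a k.
Proof. by have [/andP[]] := fA k. Qed.

Let phi_ge0 k u : 0 <= phi k u.
Proof. by have [] := phiB k. Qed.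

Let phi_weight k : radial_weight (phi k).
Proof. by have [? ? _ _ _] := phiB k; apply: radial_weight_continuous. Qed.

Let term_weight k : radial_weight (fun u => a k * phi k u).
Proof. by apply: radial_weightZ => //; exact: ltW. Qed.

Definition partial_weight m u : R := \sum_(0 <= j < m) a j * phi j u.

Definition weight u : R := partial_weight (Num.truncn u).+1 u.

Lemma term_eq0 j u : u <= j%:R -> (0 < j)%N -> phi j u = 0.
Proof.
move=> uj j0; have [_ _ _ h _] := phiB j; apply: h.
have j1 : 1 <= j%:R :> R by rewrite ler1n.
by rewrite distrC (le_trans _ (ler_norm _)) // centerE; lra.
Qed.

Lemma partial_weight_stable m m' u : (0 < m)%N -> (m <= m')%N -> u <= m%:R ->
  partial_weight m' u = partial_weight m u.
Proof.
move=> m0 mm' um; rewrite /partial_weight (big_cat_nat (leq0n m) mm') //=.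
rewrite -[RHS]addr0; congr (_ + _); rewrite big_nat_cond big1 // => j /andP[/andP[mj _] _].
rewrite term_eq0 ?mulr0 //; last exact: leq_trans mj.
by rewrite (le_trans um) // ler_nat.
Qed.

Lemma weightE m u : (0 < m)%N -> u <= m%:R -> weight u = partial_weight m u.
Proof.
move=> m0 um; rewrite /weight.
have ut : u <= (Num.truncn u).+1%:R by rewrite ltW // real_truncnS_gt ?num_real.
case: (leqP m (Num.truncn u).+1) => h; first exact: partial_weight_stable.
by apply/esym/partial_weight_stable => //; exact: ltnW.
Qed.

Lemma continuous_weight : continuous weight.
Proof.
move=> u; pose m := (Num.truncn u).+1.
have um : u < m%:R by rewrite real_truncnS_gt ?num_real.
have cm k : continuous (partial_weight k).
  elim: k => [|k IH].
    rewrite (_ : partial_weight 0 = cst 0); first by move=> v; exact: cvg_cst.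
    by apply/funext => v; rewrite /partial_weight big_nil.
  rewrite (_ : partial_weight k.+1 = (fun v => partial_weight k v + a k * phi k v)).
    move=> v; apply: cvgD; first exact: IH.
    apply: cvgM; first exact: cvg_cst.
    by have [+ _ _ _ _] := phiB k; apply.
  by apply/funext => v; rewrite /partial_weight big_nat_recr.
rewrite /continuous_at (weightE m) ?(ltW um) //.
apply: cvg_trans (cm m u); apply: near_eq_cvg.
near=> v; rewrite (weightE m) //; apply/ltW.
near: v; exact: lt_nbhsl.
Unshelve. all: by end_near. Qed.

Lemma weight_ge0 u : 0 <= weight u.
Proof. by apply: sumr_ge0 => j _; rewrite mulr_ge0 ?phi_ge0 ?ltW. Qed.

Lemma term_le_weight k u : a k * phi k u <= weight u.
Proof.
pose m := maxn k.+1 (Num.truncn u).+1.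
rewrite (weightE m); [|by rewrite leq_max|]; last first.
  rewrite (@le_trans _ _ (Num.truncn u).+1%:R) ?ler_nat ?leq_maxr //.
  by rewrite ltW // real_truncnS_gt ?num_real.
rewrite /partial_weight big_mkord (bigD1 (Ordinal (leq_maxl k.+1 (Num.truncn u).+1))) //=.
by rewrite lerDl sumr_ge0 // => j _; rewrite mulr_ge0 ?phi_ge0 ?ltW.
Qed.

Lemma weight_gt0 u : 0 <= u -> 0 < weight u.
Proof.
move=> u0; pose j := Num.truncn (u / 2).
have /truncn_itv/andP[h1 h2] : 0 <= u / 2 by rewrite divr_ge0.
apply: lt_le_trans (term_le_weight j u); rewrite mulr_gt0 //.
have [_ _ h _ _] := phiB j; apply: h.
rewrite -/j -[j.+1]addn1 natrD in h1 h2.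
rewrite centerE ltr_norml.
by apply/andP; split; lra.
Qed.

Lemma radial_weight_weight : radial_weight weight.
Proof. by apply: radial_weight_continuous; [exact: continuous_weight|exact: weight_ge0]. Qed.

Lemma mom_weight n : mom n weight = (\sum_(0 <= j <oo) (a j)%:E * mom n (phi j))%E.
Proof.
rewrite (@eq_eseriesr _ _ (fun j => (\int[plane]_p (sqnorm p ^+ n * (a j * phi j (sqnorm p)))%:E)%E)).
  rewrite -integral_nneseries //; last 2 first.
  - move=> j; have [mw _] := term_weight j.
    exact: (measurable_sqnorm_comp _ (measurable_mom n _ mw)).
  - move=> j p _; rewrite lee_fin.
    exact: (mom_integrand_ge0 n _ (term_weight j) _ (sqnorm_ge0 p)).
  apply: eq_integral => p _; have := sqnorm_ge0 p; move: (sqnorm p) => u u0.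
  apply/esym/lim_near_cst => //.
  exists (Num.truncn u).+1 => // m /= hm.
  rewrite sumEFin -mulr_sumr; congr ((_ * _)%:E).
  rewrite (weightE m) //; first exact: leq_trans hm.
  rewrite (@le_trans _ _ (Num.truncn u).+1%:R) ?ler_nat //.
  by rewrite ltW // real_truncnS_gt ?num_real.
by move=> j _; rewrite -momZ ?(ltW (a_gt0 _)).
Qed.

Lemma mom_term_le j n : (mom n (phi j) <= (2 * (center j + 3 / 2) ^+ n)%:E)%E.
Proof.
have [_ _ _ h1 h2] := phiB j; have c1 := center_ge1 j.
apply: (@le_trans _ _ (((center j + 3 / 2) ^+ n)%:E * mom 0 (phi j))%E).
  apply: mom_le_of_support => //; last by lra.
  by move=> u hu; apply: h1; rewrite (le_trans _ (ler_norm _)) //; lra.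
rewrite [leRHS](_ : _ = ((center j + 3 / 2) ^+ n)%:E * 2%:E)%E; last by rewrite -EFinM mulrC.
apply: lee_wpmul2l.
  by rewrite lee_fin exprn_ge0 //; lra.
by have /andP[_] := h2 0 (leq0n _); rewrite expr0 mulr1.
Qed.

Lemma stage_monotone i j : (i <= j)%N -> a j <= a i /\ (high (f i) <= high (f j))%N.
Proof.
elim: j => [|j IH]; first by rewrite leqn0 => /eqP ->.
rewrite leq_eqVlt => /orP[/eqP -> //|]; rewrite ltnS => /IH [h1 h2].
have [l1 e1] := fS j; split.
  have c1 := center_ge1 j.+1.
  apply: le_trans h1; rewrite /a -e1 -mulrA ler_peMr //; first exact: ltW (a_gt0 _).
  by apply: mulr_ege1; apply: exprn_ege1; lra.
by rewrite (leq_trans h2) // (leq_trans l1) // leq_addr.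
Qed.

Lemma mom_term_other k j n : (low (f k) <= n <= high (f k))%N -> j != k ->
  ((a j)%:E * mom n (phi j) <= ((1 / 2) ^+ j.+1 * (a k * center k ^+ n))%:E)%E.
Proof.
move=> /andP[ln nh] jk; have ck := center_ge1 k.
apply: (@le_trans _ _ ((a j)%:E * (2 * (center j + 3 / 2) ^+ n)%:E)%E).
  by apply: lee_wpmul2l; [rewrite lee_fin ltW|exact: mom_term_le].
have [aj1 _ _] := fA j; have cj := center_ge1 j.
have h2 m : (1 / 2) ^+ m * 2 ^+ m = 1 :> R by rewrite -exprMn divfK // expr1n.
have p2 m : 0 < 2 ^+ m :> R by rewrite exprn_gt0.
have p12 m : 0 < (1 / 2) ^+ m :> R by rewrite exprn_gt0 //; lra.
rewrite -EFinM lee_fin; case: (ltngtP j k) jk => // h _.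
  have [_ _ /(_ n ln) hk] := fA k.
  apply: (@le_trans _ _ (2 * (center k - 1 / 2) ^+ n)).
    have [/andP[aj0 {}aj1] _ _] := fA j.
    rewrite -[leRHS]mul1r; apply: ler_pM => //; first exact: ltW.
      by rewrite mulr_ge0 // exprn_ge0 //; lra.
    rewrite ler_pM2l //; apply: lerXn2r; rewrite ?nnegrE; try lra.
    have : j.+1%:R <= k%:R :> R by rewrite ler_nat.
    by rewrite -natr1 !centerE; lra.
  have -> : 2 * (center k - 1 / 2) ^+ n = (1 / 2) ^+ k * (2 * 2 ^+ k * (center k - 1 / 2) ^+ n).
    rewrite -[LHS]mul1r -[X in X * _](h2 k).
    by move: ((1 / 2) ^+ k) (2 ^+ k) (_ ^+ n) => x y z; ring.
  apply: ler_pM => //.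
    by rewrite !mulr_ge0 ?exprn_ge0 //; lra.
  by apply: ler_wiXn2l => //; lra.
case: j h aj1 cj => // j; rewrite ltnS => kj _ cj.
have [aj hj] := stage_monotone k j kj.
have [_ e1] := fS j.
have X : (center j.+1 + 3 / 2) ^+ n <= (center j.+1 + 3 / 2) ^+ high (f j).
  by apply: ler_weXn2l; [lra|exact: leq_trans hj].
have Y : 1 <= center k ^+ n by exact: exprn_ege1.
apply: (@le_trans _ _ ((1 / 2) ^+ j.+2 * a j)); last first.
  by rewrite ler_pM2l // (le_trans aj) // ler_peMr // ltW.
rewrite /a -e1 (exprS 2 j.+2).
have -> : (1 / 2) ^+ j.+2 * (amp (f j.+1) * (2 * 2 ^+ j.+2) * (center j.+1 + 3 / 2) ^+ high (f j))
  = amp (f j.+1) * (2 * (center j.+1 + 3 / 2) ^+ high (f j)) * ((1 / 2) ^+ j.+2 * 2 ^+ j.+2).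
  by move: (_ ^+ j.+2) (_ ^+ j.+2) (_ ^+ high _) => x y z; ring.
rewrite h2 mulr1 ler_pM2l; last exact: a_gt0.
by rewrite ler_pM2l.
Qed.

Lemma sum_half_pow m : \sum_(0 <= j < m) (1 / 2) ^+ j.+1 <= 1 :> R.
Proof.
rewrite (_ : \sum_(_ <= _ < _) _ = 1 - (1 / 2) ^+ m).
  by rewrite gerBl exprn_ge0 //; lra.
elim: m => [|m IH]; first by rewrite big_nil expr0 subrr.
by rewrite big_nat_recr //= IH exprS; lra.
Qed.

Lemma sum_indicator_le k m : \sum_(0 <= j < m) (j == k)%:R <= 1 :> R.
Proof.
rewrite (_ : \sum_(_ <= _ < _) _ = (k < m)%N%:R).
  by case: (_ < _)%N.
elim: m => [|m IH]; first by rewrite big_nil.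
rewrite big_nat_recr //= IH -natrD; congr (_%:R).
by rewrite ltnS; case: (ltngtP k m).
Qed.

Lemma mom_weight_bounds k n : (low (f k) <= n <= high (f k))%N ->
  ((a k * center k ^+ n / 2)%:E <= mom n weight <= (3 * (a k * center k ^+ n))%:E)%E.
Proof.
move=> hn; have /andP[ln nh] := hn.
have [_ _ _ _ /(_ n nh) /andP[h1 h2]] := phiB k.
have A0 : 0 < a k * center k ^+ n.
  by rewrite mulr_gt0 // exprn_gt0 // (lt_le_trans _ (center_ge1 k)).
set A := a k * center k ^+ n in A0 *.
have t0 j : (0 <= (a j)%:E * mom n (phi j))%E.
  by rewrite mule_ge0 ?mom_ge0 // lee_fin ltW.
apply/andP; split.
  apply: (@le_trans _ _ ((a k)%:E * mom n (phi k))%E).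
    rewrite /A -mulrA EFinM; apply: lee_wpmul2l => //.
    by rewrite lee_fin ltW.
  rewrite -momZ ?(ltW (a_gt0 _)) //; have [mw _] := term_weight k.
  have [mW _] := radial_weight_weight.
  apply: le_radint; [exact: measurable_mom|exact: measurable_mom|].
  move=> u u0; apply/andP; split; first exact: (mom_integrand_ge0 _ _ (term_weight k)).
  by apply: ler_wpM2l; [exact: exprn_ge0|exact: term_le_weight].
rewrite mom_weight; apply: lime_le.
  by apply: is_cvg_nneseries.
apply: nearW => m.
apply: (@le_trans _ _ (\sum_(0 <= j < m) ((1 / 2) ^+ j.+1 * A + (j == k)%:R * (2 * A))%:E)%E).
  apply: lee_sum => j _.
  have [->|jk] := eqVneq j k.
    apply: (@le_trans _ _ (2 * A)%:E); last first.
      by rewrite lee_fin [X in _ + X]mul1r lerDr mulr_ge0 ?exprn_ge0 ?(ltW A0) //; lra.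
    rewrite /A mulrCA EFinM; apply: lee_wpmul2l => //.
    by rewrite lee_fin ltW.
  by rewrite [X in _ + X]mul0r addr0; exact: mom_term_other.
rewrite sumEFin lee_fin big_split /= -!mulr_suml.
have := sum_half_pow m; have := sum_indicator_le k m.
move: (\sum_(_ <= _ < _) _) (\sum_(_ <= _ < _) _) => x y hx hy; nra.
Qed.

End Sum.

Lemma clustered_weight_exists : exists w : R -> R,
  [/\ continuous w, (forall u, 0 <= u -> 0 < w u) &
  forall k, exists N d c A, [/\ 0 < c, 0 < A, interpolated N c k.+1%:R d &
    forall n, (N <= n <= N + d.*2)%N ->
      ((A * c ^+ n / 2)%:E <= mom n w <= (3 * (A * c ^+ n))%:E)%E]].
Proof.
have [f [fA fS]] := stages_exist.
have [phi phiB] := choice (fun k => bump_exists (center k) (high (f k)) (center_ge1 k)).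
exists (weight f phi); split.
- exact: continuous_weight.
- exact: weight_gt0.
- move=> k; have [/andP[a0 _] hi _] := fA k.
  exists (low (f k)), (gap (f k)), (center k), (amp (f k)); split => //.
  by move=> n hn; exact: mom_weight_bounds.
Qed.

End ClusteredWeight.

Section Fock.
Context {R : realType}.
Implicit Types (h : R -> R) (n : nat).

Definition radial_density h (u : R) : R := expR (- h (Num.sqrt u)).

Definition monomial n (z : R[i]) : R[i] := z ^+ n.

Lemma entire_monomial n : entire (monomial n).
Proof. by move=> C z; exact: exprn_derivable. Qed.

Lemma normc_sqnorm (x y : R) : Normc.normc (Complex x y) = Num.sqrt (sqnorm (x, y)).
Proof. by []. Qed.

Lemma normc_monomial n (z : R[i]) : Normc.normc (monomial n z) = Normc.normc z ^+ n.
Proof.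
elim: n => [|n IH]; first by rewrite /monomial !expr0 Normc.normc1.
by rewrite /monomial !exprS Normc.normcM -IH.
Qed.

Lemma fock_sqnorm_monomial h n : fock_sqnorm h (monomial n) = mom n (radial_density h).
Proof.
apply: eq_integral => -[x y] _ /=; congr (_%:E).
by rewrite normc_monomial normc_sqnorm -exprM mulnC exprM sqr_sqrtr ?sqnorm_ge0.
Qed.

Lemma radial_weight_density h : {within `[0, +oo[, continuous h} ->
  radial_weight (radial_density h).
Proof.
move=> ch; split; last by move=> u _; exact: expR_ge0.
have mh : measurable_fun (`[0, +oo[%classic : set R) h.
  by apply: subspace_continuous_measurable_fun => //; exact: measurable_itv.
have mhs : measurable_fun setT (h \o Num.sqrt).
  apply: (measurable_comp (measurable_itv _) _ mh).
    by move=> _ [u _ <-] /=; rewrite in_itv /= sqrtr_ge0.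
  by apply: continuous_measurable_fun; exact: sqrt_continuous.
rewrite /radial_density -/(expR \o (fun u => - h (Num.sqrt u))).
apply: measurableT_comp; first exact: measurable_expR.
exact: (measurable_funN mhs).
Qed.

Lemma radial_density_nonincreasing h :
  {in `[0, +oo[ &, {homo h : x y / x <= y}} ->
  {in `[0, +oo[ &, {homo radial_density h : x y / x <= y >-> y <= x}}.
Proof.
move=> hm x y _ _ xy; rewrite ler_expR lerN2.
by apply: hm; rewrite ?in_itv /= ?sqrtr_ge0 // ler_wsqrtr.
Qed.

Lemma fock_coincide_mom h1 h2 : fock_coincide h1 h2 ->
  radial_weight (radial_density h1) -> radial_weight (radial_density h2) ->
  exists2 cC : R * R, 0 < cC.1 /\ 0 < cC.2 & forall n,
    (mom n (radial_density h1) < +oo)%E ->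
    (cC.1%:E * mom n (radial_density h1) <= mom n (radial_density h2) <=
     cC.2%:E * mom n (radial_density h1))%E.
Proof.
move=> [hs [c [C [c0 C0 hcC]]]] w1 w2; exists (c ^+ 2, C ^+ 2).
  by rewrite !exprn_gt0.
move=> n m1; have in1 : fock_space h1 (monomial n).
  by split; [exact: entire_monomial|rewrite fock_sqnorm_monomial].
have [_] : fock_space h2 (monomial n) by rewrite -hs.
rewrite fock_sqnorm_monomial => m2.
have := hcC _ in1; rewrite /fock_norm !fock_sqnorm_monomial.
have f1 : mom n (radial_density h1) \is a fin_num by rewrite ge0_fin_numE // mom_ge0.
have f2 : mom n (radial_density h2) \is a fin_num by rewrite ge0_fin_numE // mom_ge0.
have := mom_ge0 n _ w1; have := mom_ge0 n _ w2.
rewrite -(fineK f1) -(fineK f2) /= -!EFinM !lee_fin.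
move: (fine _) (fine _) => y x y0 x0 /andP[h3 h4].
rewrite -{1}(sqr_sqrtr x0) -{2}(sqr_sqrtr x0) -(sqr_sqrtr y0) -!exprMn.
by apply/andP; split; apply: lerXn2r; rewrite ?nnegrE ?mulr_ge0 ?sqrtr_ge0 ?(ltW c0) ?(ltW C0).
Qed.

End Fock.

Theorem proposition1p4 (R : realType) :
  exists h0 : R -> R,
    {within `[0, +oo[, continuous h0} /\
    forall h : R -> R,
      {within `[0, +oo[, continuous h} ->
      {in `[0, +oo[ &, {homo h : x y / x <= y}} ->
      ~ fock_coincide h0 h.
Proof.
have [w [cw w0 hw]] := @clustered_weight_exists R.
pose h0 (r : R) := - ln (w (r ^+ 2)).
have d0 u : 0 <= u -> radial_density h0 u = w u.
  by move=> u0; rewrite /radial_density /h0 opprK sqr_sqrtr // lnK // posrE w0.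
have ch0 : continuous h0.
  move=> r; apply: cvgN.
  apply: (@continuous_comp _ _ _ (fun r : R => w (r ^+ 2)) (@ln R)); last first.
    by apply: continuous_ln; rewrite w0 // sqr_ge0.
  apply: (@continuous_comp _ _ _ (fun r : R => r ^+ 2) w); last exact: cw.
  exact: exprn_continuous.
have ch0' : {within `[0, +oo[, continuous h0} by exact: continuous_subspaceT.
exists h0; split => // h ch hmono hcoin.
have wh0 := radial_weight_density h0 ch0'.
have wh := radial_weight_density h ch.
have [[c C] /= [c0 C0] hc] := fock_coincide_mom h0 h hcoin wh0 wh.
have momE n : mom n (radial_density h0) = mom n w.
  by apply: eq_radint => u u0; rewrite d0.
pose k := Num.truncn (12 * C / c).
have [N [d [e [A [e0 A0 interp hA]]]]] := hw k.
have := interp _ wh (radial_density_nonincreasing h hmono).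
have bounds n : (N <= n <= N + d.*2)%N ->
    ((c * (A * e ^+ n / 2))%:E <= mom n (radial_density h) <= (C * (3 * (A * e ^+ n)))%:E)%E.
  move=> /hA /andP[l1 l2]; have := hc n; rewrite momE => /(_ (le_lt_trans l2 (ltry _))).
  move=> /andP[l3 l4]; apply/andP; split.
    by apply: le_trans l3; rewrite EFinM; apply: lee_wpmul2l => //; rewrite lee_fin ltW.
  by apply: (le_trans l4); rewrite EFinM; apply: lee_wpmul2l => //; rewrite lee_fin ltW.
have /andP[b1 _] := bounds (N + d)%N ltac:(lia).
have /andP[_ b2] := bounds N ltac:(lia).
have /andP[_ b3] := bounds (N + d.*2)%N ltac:(lia).
have ed0 : 0 < e ^+ d by rewrite exprn_gt0.
have eN0 : 0 < e ^+ N by rewrite exprn_gt0.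
have k0 : 0 < k.+1%:R :> R by rewrite ltr0Sn.
move=> main; suff : c * (A * e ^+ (N + d) / 2) <=
    e ^+ d / k.+1%:R * (C * (3 * (A * e ^+ N))) +
    (k.+1%:R * e ^+ d)^-1 * (C * (3 * (A * e ^+ (N + d.*2)))).
  rewrite -addnn !exprD => F.
  have : 12 * C / c < k.+1%:R by rewrite real_truncnS_gt ?num_real.
  rewrite ltr_pdivrMr // ltNge => /negP; apply.
  have P0 : 0 < A * e ^+ N * e ^+ d / (2 * k.+1%:R) by rewrite !(mulr_gt0, invr_gt0).
  rewrite -(ler_pM2l P0); move: F; move: k.+1%:R k0 P0 => B B0 _ F.
  rewrite (_ : _ * (B * c) = c * (A * (e ^+ N * e ^+ d) / 2)); last first.
    by field; rewrite gt_eqF.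
  apply: (le_trans F); rewrite le_eqVlt; apply/orP; left; apply/eqP.
  by field; rewrite !gt_eqF.
rewrite -lee_fin; apply: (le_trans b1); apply: (le_trans main).
rewrite EFinD; apply: leeD; rewrite (EFinM _ (C * _)); apply: lee_wpmul2l => //;
  by rewrite lee_fin ?invr_ge0 ?divr_ge0 ?mulr_ge0 ?ltW.
Qed.
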